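(* There exists an absolute constant $C>0$ with the following property. For every integer $d\ge 1$ and every sufficiently large integer $n$ there exist a measurable set $E\subseteq\mathbb{R}^d$, an $n$-point configuration $P\subseteq\mathbb{R}^d$ contained in a line, and a sequence of positive numbers $(r_j)_j$ with $r_j\to\infty$, such that the density $\mathrm{d}(E)$ exists and satisfies \[ \mathrm{d}(E)\ge 1-C\,\frac{\log n}{n}, \] and $E$ contains no isometric copy of $r_jP$ for any $j$.
   Context: For a measurable set $E\subseteq\mathbb{R}^d$, $|E|$ denotes its Lebesgue measure, and its density is \[ \mathrm{d}(E):=\lim_{R\to\infty}\frac{|E\cap[-R/2,R/2]^d|}{R^d}, \] provided the limit exists. An $n$-point configuration is a set of exactly $n$ points. For a finite set $P\subseteq\mathbb{R}^d$ and $r\in(0,\infty)$, an isometric copy of $rP$ is a set $Y\subseteq\mathbb{R}^d$ for which there exists a bijection $\phi\colon P\to Y$ with $\|\phi(u)-\phi(v)\|_2=r\|u-v\|_2$ for all $u,v\in P$, where $\|\cdot\|_2$ is the Euclidean norm. ''$E$ contains an isometric copy of $rP$'' means that some isometric copy $Y$ of $rP$ satisfies $Y\subseteq E$. The logarithm has base $e$. *)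

(* Defs.v *)
From HB Require Import structures.
From mathcomp Require Import all_boot all_order all_algebra.
From mathcomp Require Import all_classical all_reals all_analysis.

Set Implicit Arguments.
Unset Strict Implicit.
Unset Printing Implicit Defensive.

Import Order.TTheory GRing.Theory Num.Theory.
Import numFieldNormedType.Exports.

Local Open Scope classical_set_scope.
Local Open Scope ring_scope.

Definition cons_pair (R : realType) (d : nat)
    (p : measurableTypeR R * d.-tuple (measurableTypeR R)) :
    d.+1.-tuple (measurableTypeR R) :=
  [tuple of p.1 :: p.2].

(* The d-fold product of the one-dimensional Lebesgue measure, to be read as a
   measure on the product sigma-algebra, i.e. on the Borel sets of R^d. *)
Fixpoint lebesgue_tuple (R : realType) (d : nat) :
    set (d.-tuple (measurableTypeR R)) -> \bar R :=
  match d with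
  | 0 => \d_([tuple] : 0.-tuple (measurableTypeR R))
  | d'.+1 =>
      pushforward (@lebesgue_measure R \x @lebesgue_tuple R d')%E
        (@cons_pair R d')
  end.

Lemma measurable_cons_pair (R : realType) (d : nat) :
  measurable_fun setT (@cons_pair R d).
Proof. exact: measurable_cons. Qed.

Section lebesgue_step.
Context (R : realType) (d : nat).
Variable m : {sigma_finite_measure set (d.-tuple (measurableTypeR R)) -> \bar R}.

Definition lebesgue_step : set (d.+1.-tuple (measurableTypeR R)) -> \bar R :=
  pushforward (@lebesgue_measure R \x m)%E (@cons_pair R d).

Let step0 : lebesgue_step set0 = 0%E.
Proof. by rewrite /lebesgue_step /pushforward preimage_set0 measure0. Qed.

Let step_ge0 A : (0 <= lebesgue_step A)%E.
Proof. by rewrite /lebesgue_step /pushforward; exact: measure_ge0. Qed.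

Let step_sigma_additive : semi_sigma_additive lebesgue_step.
Proof.
have mf := @measurable_cons_pair R d.
move=> F mF tF mUF; rewrite /lebesgue_step /pushforward preimage_bigcup.
apply: measure_semi_sigma_additive.
- by move=> n; rewrite -[X in measurable X]setTI; exact: mf.
- apply/trivIsetP => /= i j _ _ ij; rewrite -preimage_setI.
  by move/trivIsetP : tF => /(_ i j Logic.I Logic.I ij) ->;
    rewrite preimage_set0.
- by rewrite -preimage_bigcup -[X in measurable X]setTI; exact: mf.
Qed.

HB.instance Definition _ := isMeasure.Build _ _ _ lebesgue_step
  step0 step_ge0 step_sigma_additive.

Let step_sigma_finite : sigma_finite setT lebesgue_step.
Proof.
pose uncons (t : d.+1.-tuple (measurableTypeR R)) :
  measurableTypeR R * d.-tuple (measurableTypeR R) :=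
  (thead t, [tuple of behead t]).
have muncons : measurable_fun setT uncons.
  by apply: measurable_fun_pair;
    [exact: measurable_tnth | exact: measurable_behead].
have consK p : uncons (cons_pair p) = p.
  by case: p => x t; rewrite /uncons /cons_pair/= theadE;
    congr (_, _); exact: val_inj.
have /sigma_finiteP[F [TF ndF Foo]] := sigma_finiteT (@lebesgue_measure R).
have /sigma_finiteP[G [TG ndG Goo]] := sigma_finiteT m.
exists (fun n => uncons @^-1` (F n `*` G n)).
  rewrite -preimage_bigcup; apply/esym/seteqP; split=> // t _ /=.
  have [i _ Fi] : (\bigcup_n F n) (uncons t).1 by rewrite -TF.
  have [j _ Gj] : (\bigcup_n G n) (uncons t).2 by rewrite -TG.
  exists (maxn i j) => //; split.
  - by move: Fi; exact/subsetPset/ndF/leq_maxl.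
  - by move: Gj; exact/subsetPset/ndG/leq_maxr.
move=> k; have [? ?] := Foo k; have [? ?] := Goo k; split.
  by rewrite -[X in measurable X]setTI; apply: muncons => //; exact: measurableX.
rewrite /lebesgue_step /pushforward.
rewrite (_ : @cons_pair R d @^-1` _ = F k `*` G k); last first.
  rewrite -comp_preimage (_ : uncons \o _ = id)//.
  by apply/funext => p; exact: consK.
by rewrite product_measure1E// lte_mul_pinfty// ge0_fin_numE.
Qed.

HB.instance Definition _ := Measure_isSigmaFinite.Build _ _ _ lebesgue_step
  step_sigma_finite.

End lebesgue_step.

Lemma lebesgue_tupleP (R : realType) (d : nat) :
  exists m : {sigma_finite_measure set (d.-tuple (measurableTypeR R)) -> \bar R},
    (m : set _ -> \bar R) = @lebesgue_tuple R d.
Proof.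
elim: d => [|d [m mE]].
  by exists (\d_([tuple] : 0.-tuple (measurableTypeR R))).
by exists (lebesgue_step m); rewrite /= -mE.
Qed.

Section lebesgue_tuple_measure.
Context (R : realType) (d : nat).

Let lebesgue_tuple0 : @lebesgue_tuple R d set0 = 0%E.
Proof. by have [m <-] := lebesgue_tupleP R d; exact: measure0. Qed.

Let lebesgue_tuple_ge0 A : (0 <= @lebesgue_tuple R d A)%E.
Proof. by have [m <-] := lebesgue_tupleP R d; exact: measure_ge0. Qed.

Let lebesgue_tuple_sigma_additive : semi_sigma_additive (@lebesgue_tuple R d).
Proof.
by have [m <-] := lebesgue_tupleP R d; exact: measure_semi_sigma_additive.
Qed.

HB.instance Definition _ := isMeasure.Build _ _ _ (@lebesgue_tuple R d)
  lebesgue_tuple0 lebesgue_tuple_ge0 lebesgue_tuple_sigma_additive.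

Let lebesgue_tuple_sigma_finite : sigma_finite setT (@lebesgue_tuple R d).
Proof. by have [m <-] := lebesgue_tupleP R d; exact: sigma_finiteT. Qed.

HB.instance Definition _ := Measure_isSigmaFinite.Build _ _ _
  (@lebesgue_tuple R d) lebesgue_tuple_sigma_finite.

End lebesgue_tuple_measure.

Definition row_of_tuple (R : realType) (d : nat)
    (t : d.-tuple (measurableTypeR R)) : 'rV[R]_d :=
  \row_i tnth t i.

(* Lebesgue measurability is taken in the full (completed) sense, as
   Caratheodory measurability for the Lebesgue outer measure, so every Borel set
   and every null set is measurable. *)
Definition lebesgue_measurable (R : realType) (d : nat) (E : set 'rV[R]_d) :=
  ((@lebesgue_tuple R d)^*)%mu.-cara.-measurable (@row_of_tuple R d @^-1` E).

(* The Lebesgue outer measure, which is |E| when E is Lebesgue measurable. *)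
Definition lebesgue_vol (R : realType) (d : nat) (E : set 'rV[R]_d) : \bar R :=
  ((@lebesgue_tuple R d)^*)%mu (@row_of_tuple R d @^-1` E).

Definition cube (R : realType) (d : nat) (s : R) : set 'rV[R]_d :=
  [set x | forall i, - (s / 2) <= x 0 i <= s / 2].

(* d(E) exists and is equal to delta. *)
Definition has_density (R : realType) (d : nat) (E : set 'rV[R]_d)
    (delta : R) : Prop :=
  (lebesgue_vol (E `&` cube s) * (s ^+ d)^-1%:E)%E @[s --> +oo] --> delta%:E.

(* The norm `|u - v| of the library on 'rV[R]_d is the sup norm. *)
Definition edist (R : realType) (d : nat) (u v : 'rV[R]_d) : R :=
  Num.sqrt (\sum_i (u 0 i - v 0 i) ^+ 2).

Definition isometric_copy (R : realType) (d : nat) (r : R)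
    (P Y : set 'rV[R]_d) : Prop :=
  exists2 phi : 'rV[R]_d -> 'rV[R]_d, set_bij P Y phi &
    forall u v, P u -> P v -> edist (phi u) (phi v) = r * edist u v.

Definition contains_isometric_copy (R : realType) (d : nat) (r : R)
    (P E : set 'rV[R]_d) : Prop :=
  exists2 Y, isometric_copy r P Y & Y `<=` E.

Definition contained_in_line (R : realType) (d : nat) (P : set 'rV[R]_d) : Prop :=
  exists a v : 'rV[R]_d, v != 0 /\ P `<=` [set a + t *: v | t in [set: R]].

(* Main.v *)
Require Import Defs.
From HB Require Import structures.
From mathcomp Require Import all_boot all_order all_algebra.
From mathcomp Require Import all_classical all_reals all_analysis.
From mathcomp Require Import measurable_realfun ring lra zify.

Set Implicit Arguments.
Unset Strict Implicit.
Unset Printing Implicit Defensive.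

Import Order.TTheory GRing.Theory Num.Theory.
Import numFieldNormedType.Exports.

Local Open Scope classical_set_scope.
Local Open Scope ring_scope.

(** Write frac for the fractional part.  The set E consists of the points x for
which frac(|x|^2) is not in [0, 3/K[, where K is about n / (144 log n).  It omits
a set of thin spherical shells; the theorem holds because an isometric copy of
a dilate of a well chosen collinear P cannot avoid these shells.

An isometric copy of collinear points is again collinear, so |.|^2 is a
quadratic polynomial along it.  Take P to be the points p e_0 with p in a set ps
of n natural numbers, and r_j^2 = j + 1 + alpha with alpha = 1/(16 K^2)^2.  On a
copy of r_j P the value of |.|^2 at the point of index p is
r_j^2 p^2 + b p + c for some real b and c, which is alpha p^2 + b p + c modulo 1
([sqnorm_collinear_copy], [shells_hit_copies]).  It therefore suffices to find
n natural numbers ps such that, for every b and c, some p in ps satisfies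
frac(alpha p^2 + b p + c) < 3/K.

Such a ps is extracted from a set of candidates p = u + 16 K^2 v with u in
{0, 1} and v < 204 K^4.  For fixed u, alpha p^2 + b p + c is modulo 1 an affine
function of v, with slope u/(8 K^2) + 16 K^2 b.  At least one of the two slopes
is not too close to a rational of denominator at most 2K, and then a multiple s
of bounded size moves it by between 1/(2K) and 1/K modulo 1 ([good_slope]).
Steps of that length cannot jump over an arc of length 1/K, so every v has a
translate by one of O(K) multiples of s whose value lies in [0, 1/K[; hence a
proportion 1/(16K) of the candidates works for each (b, c)
([candidate_density]).  As the candidates are integers of polynomial size, (b, c)
may be rounded to a grid of 3264 K^8 points.  Choosing candidates greedily
multiplies the number of unserved grid points by 1 - 1/(16K) at each step, so
that O(K log K) steps serve all of them ([greedy_hitting], [universal_hitting]).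

For the density, one-dimensional slices suffice.  In dimension one the set
frac(x^2 + s) < l is a union of intervals whose lengths are compared with the
gaps between consecutive square roots by concavity; the sum telescopes, and the
measure inside [-T, T] is at most 2 l T + 8 uniformly in s ([frac_sqr_measure]).
Slicing along the first coordinate, which only changes s, gives
(2T)^(d-1) (2 l T + 8) in dimension d ([frac_sqnorm_measure]).  The
complementary condition on frac(|x|^2) has the same form with 1 - l and another
shift, so the upper bound also yields the lower bound and the density is
exactly 1 - l ([shellsC_density]). *)

(** * Fractional parts and Dirichlet approximation *)

Definition frac_lt (R : realType) (l x : R) : bool :=
  x - (Num.floor x)%:~R < l.

(** The existential form is invariant under integer translations by inspection and
is what linear arithmetic can use; [l <= 1] makes the integer unique. *)
Lemma frac_ltP (R : realType) (l x : R) :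
  l <= 1 ->
  reflect (exists z : int, z%:~R <= x < z%:~R + l) (frac_lt l x).
Proof.
move=> l1; apply: (iffP idP) => [h|[z /andP[zx xz]]].
  exists (Num.floor x); rewrite floor_le /=; move: h; rewrite /frac_lt; lra.
rewrite /frac_lt (@floor_def _ x z); first by lra.
by rewrite zx /= intrD; lra.
Qed.

Lemma frac_ltDint (R : realType) (l x : R) (z : int) :
  frac_lt l (x + z%:~R) = frac_lt l x.
Proof. by rewrite /frac_lt floorDrz ?intr_int// intrKfloor intrD; congr (_ < _); lra. Qed.

(** Pigeonhole: two of the [Q + 1] fractional parts of the multiples
[0, theta, ..., Q theta] lie in the same of the [Q] boxes of length [1/Q]. *)
Lemma dirichlet (R : realType) (theta : R) (Q : nat) : (0 < Q)%N ->
  exists (q : nat) (z : int), (0 < q <= Q)%N /\ `|q%:R * theta - z%:~R| <= Q%:R^-1.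
Proof.
move=> Q0.
have Q0' : 0 < Q%:R :> R by rewrite ltr0n.
pose fr (x : R) := x - (Num.floor x)%:~R.
have fr0 x : 0 <= fr x by rewrite subr_ge0 floor_le.
have fr1 x : fr x < 1.
  by rewrite /fr; have := floorD1_gt x; rewrite intrD; lra.
pose box (i : 'I_Q.+1) : nat := Num.trunc (Q%:R * fr (i%:R * theta)).
have boxP i : (box i)%:R <= Q%:R * fr (i%:R * theta) < (box i).+1%:R.
  by apply: truncn_itv; apply: mulr_ge0 => //; exact: ltW.
have boxlt i : (box i < Q)%N.
  have /andP[h _] := boxP i; rewrite -(ltr_nat R).
  apply: le_lt_trans h _; rewrite -[ltRHS]mulr1 ltr_pM2l//.
have : ~~ injectiveb (fun i => Ordinal (boxlt i)).
  by apply/negP => /injectiveP /leq_card; rewrite !card_ord ltnn.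
move=> /injectivePn[i [j ij [bij]]].
wlog lij : i j ij bij / (i < j)%N.
  move=> W; have [h|h|/val_inj h] := ltngtP i j.
  - exact: (W i j).
  - by apply: (W j i) => //; rewrite eq_sym.
  - by rewrite h eqxx in ij.
exists (j - i)%N, (Num.floor (j%:R * theta) - Num.floor (i%:R * theta)).
split; first by have := ltn_ord j; move: lij; clear; lia.
rewrite natrB ?(ltnW lij)// intrB.
have -> : (j%:R - i%:R) * theta -
   ((Num.floor (j%:R * theta))%:~R - (Num.floor (i%:R * theta))%:~R) =
   fr (j%:R * theta) - fr (i%:R * theta) by rewrite /fr; ring.
rewrite -(ler_pM2l Q0') divff ?gt_eqF// -[X in X * `|_|]gtr0_norm// -normrM mulrBr.
have /andP := boxP i; have /andP := boxP j; rewrite -bij -natr1 => -[? ?] [? ?].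
rewrite ler_norml; apply/andP; split; lra.
Qed.

(** * A slope that advances by a controlled step modulo one *)

(** If both slopes had a small multiple very close to an integer, then
eliminating [theta] would place [q q' / (8 K^2)] at distance less than
[1 / (8 K^2)] from an integer.  This is impossible because
[0 < q q' <= 4 K^2 < 8 K^2]. *)
Lemma slope_dichotomy (R : realType) (theta : R) (K q q' : nat) (z z' : int) :
  (0 < K)%N -> (0 < q <= 2 * K)%N -> (0 < q' <= 2 * K)%N ->
  `|q%:R * theta - z%:~R| < (32 * K%:R ^+ 3)^-1 ->
  (32 * K%:R ^+ 3)^-1 <= `|q'%:R * (theta + (8 * K%:R ^+ 2)^-1) - z'%:~R|.
Proof.
move=> K0 /andP[q0 qK] /andP[q0' qK'].
set k : R := K%:R.
have k0 : 0 < k by rewrite ltr0n.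
have k1 : 1 <= k by rewrite ler1n.
set e : R := _ - _ => he; set e' : R := _ - _; rewrite leNgt; apply/negP => he'.
have qk : q%:R <= 2 * k by rewrite /k -natrM ler_nat.
have qk' : q'%:R <= 2 * k by rewrite /k -natrM ler_nat.
have qe : `|q%:R * e'| < (16 * k ^+ 2)^-1.
  rewrite normrM ger0_norm//; apply: (@le_lt_trans _ _ (2 * k * `|e'|)).
    by rewrite ler_wpM2r.
  have -> : (16 * k ^+ 2)^-1 = 2 * k * (32 * k ^+ 3)^-1 by field; rewrite gt_eqF.
  by rewrite ltr_pM2l// mulr_gt0.
have qe' : `|q'%:R * e| < (16 * k ^+ 2)^-1.
  rewrite normrM ger0_norm//; apply: (@le_lt_trans _ _ (2 * k * `|e|)).
    by rewrite ler_wpM2r.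
  have -> : (16 * k ^+ 2)^-1 = 2 * k * (32 * k ^+ 3)^-1 by field; rewrite gt_eqF.
  by rewrite ltr_pM2l// mulr_gt0.
pose N : int := q%:Z * z' - q'%:Z * z.
pose D : int := (q * q')%N%:Z - (8 * K ^ 2)%N%:Z * N.
have DE : D%:~R = 8 * k ^+ 2 * (q%:R * e' - q'%:R * e).
  have aE : (q * q')%N%:R = q%:R * q'%:R :> R by rewrite natrM.
  have bE : (8 * K ^ 2)%N%:R = 8 * k ^+ 2 :> R by rewrite natrM natrX.
  rewrite /D; move: (q * q')%N (8 * K ^ 2)%N aE bE => a b aE bE.
  rewrite /N /e /e' !(intrB, intrM) -!pmulrn aE bE.
  by field; rewrite gt_eqF.
have : `|D%:~R : R| < 1.
  rewrite DE normrM gtr0_norm; last by rewrite mulr_gt0// exprn_gt0.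
  rewrite -ltr_pdivlMl; last by rewrite mulr_gt0// exprn_gt0.
  have -> : (8 * k ^+ 2)^-1 * 1 = (16 * k ^+ 2)^-1 + (16 * k ^+ 2)^-1.
    by field; rewrite gt_eqF.
  by apply: le_lt_trans (ler_normB _ _) _; exact: ltrD.
rewrite -intr_norm ltrz1 => D1.
have D0 : D = 0 by lia.
have lt8 : (q * q' < 8 * K ^ 2)%N.
  have := leq_mul qK qK'; have : (0 < K * K)%N by rewrite muln_gt0 K0.
  rewrite -mulnn; lia.
have gt0 : (0 < q * q')%N by rewrite muln_gt0 q0.
move: D0 lt8 gt0; rewrite /D; move: (q * q')%N (8 * K ^ 2)%N => a b.
case: (lerP N 0) => hN; nia.
Qed.

(** Repeating a step of length [e], with [1/(32 K^3) <= e <= 1/(2K)], one stops as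
soon as the total exceeds [1/(2K)], which happens before it exceeds [1/K]; the
lower bound on [e] keeps the number of repetitions below [17 K^2]. *)
Lemma amplify_to_scale (R : realType) (theta : R) (K q : nat) (z : int) :
  (0 < K)%N -> (0 < q <= 2 * K)%N ->
  (32 * K%:R ^+ 3)^-1 <= `|q%:R * theta - z%:~R| <= (2 * K)%:R^-1 ->
  exists (s : nat) (y : int), (s <= 34 * K ^ 3)%N /\
    (2 * K%:R)^-1 <= `|s%:R * theta - y%:~R| <= K%:R^-1.
Proof.
move=> K0 /andP[q0 qK]; rewrite natrM.
set k : R := K%:R; set e : R := _ - _ => /andP[le_e e_le].
have k0 : 0 < k by rewrite ltr0n.
have k3 : 0 < 32 * k ^+ 3 by rewrite mulr_gt0// exprn_gt0.
have e0 : 0 < `|e| by apply: lt_le_trans le_e; rewrite invr_gt0.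
pose m := (Num.trunc ((2 * k)^-1 / `|e|)).+1.
have kk0 : 0 <= (2 * k)^-1 / `|e|.
  by rewrite divr_ge0 ?normr_ge0// invr_ge0 mulr_ge0// ltW.
have /andP[m1 m2] := truncn_itv kk0.
have mR : m%:R = (Num.trunc ((2 * k)^-1 / `|e|))%:R + 1 :> R by rewrite natr1.
exists (m * q)%N, (m%:Z * z); split.
  have : m%:R <= 17 * k ^+ 2.
    have : (2 * k)^-1 / `|e| <= 16 * k ^+ 2.
      rewrite ler_pdivrMr//.
      have -> : (2 * k)^-1 = 16 * k ^+ 2 * (32 * k ^+ 3)^-1.
        by field; rewrite gt_eqF.
      by rewrite ler_pM2l// mulr_gt0// exprn_gt0.
    have : 1 <= k ^+ 2 by rewrite exprn_ege1// ler1n.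
    rewrite mR; lra.
  rewrite /k -natrX -natrM ler_nat => mK.
  apply: leq_trans (leq_mul mK qK) _; rewrite !expnS !expn0; lia.
have -> : (m * q)%:R * theta - (m%:Z * z)%:~R = m%:R * e.
  by rewrite /e natrM intrM -pmulrn; ring.
rewrite normrM ger0_norm//.
have -> : k^-1 = (2 * k)^-1 + (2 * k)^-1 by field; rewrite gt_eqF.
move: m1 m2; rewrite -/m ler_pdivlMr// ltr_pdivrMr// => m1 m2.
rewrite (ltW m2) /= mR mulrDl mul1r lerD//.
Qed.

(** The two slopes are those met by the two families of candidates; the step [s]
is produced by Dirichlet approximation at the slope for which the dichotomy
excludes an approximation that is too good. *)
Lemma good_slope (R : realType) (theta : R) (K : nat) : (0 < K)%N ->
  exists (u : bool) (s : nat) (z : int), (s <= 34 * K ^ 3)%N /\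
    (2 * K%:R)^-1 <= `|s%:R * (theta + u%:R * (8 * K%:R ^+ 2)^-1) - z%:~R|
       <= K%:R^-1.
Proof.
move=> K0.
have [|q [z [qK qe]]] := @dirichlet R theta (2 * K).
  by rewrite muln_gt0.
have [|q' [z' [qK' qe']]] :=
    @dirichlet R (theta + (8 * K%:R ^+ 2)^-1) (2 * K).
  by rewrite muln_gt0.
have [h|h] := ltP `|q%:R * theta - z%:~R| (32 * K%:R ^+ 3)^-1.
  have h' := slope_dichotomy z' K0 qK qK' h.
  have [s [y sy]] := amplify_to_scale K0 qK' (introT andP (conj h' qe')).
  by exists true, s, y; rewrite mul1r.
have [s [y sy]] := amplify_to_scale K0 qK (introT andP (conj h qe)).
by exists false, s, y; rewrite mul0r addr0.
Qed.

(** * Counting the terms of an arithmetic progression in a short arc *)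

(** A walk on the circle with steps of length in [1/(2K), 1/K] cannot jump over
an arc of length [1/K], and it needs at most [2K + 1] steps to come round. *)
Lemma shift_hits (R : realType) (theta x : R) (K s : nat) (y : int) :
  (0 < K)%N ->
  (2 * K%:R)^-1 <= `|s%:R * theta - y%:~R| <= K%:R^-1 ->
  exists w : nat, (w <= 2 * K + 1)%N /\
    frac_lt K%:R^-1 (x + (s * w)%:R * theta).
Proof.
move=> K0; set e : R := _ - _; set k : R := K%:R => /andP[le_e e_le].
have k0 : 0 < k by rewrite ltr0n.
have k1 : k^-1 <= 1 by rewrite invf_le1// ler1n.
have e0 : 0 < `|e| by apply: lt_le_trans le_e; rewrite invr_gt0 mulr_gt0.
pose f : R := x - (Num.floor x)%:~R.
have f0 : 0 <= f by rewrite subr_ge0 floor_le.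
have f1 : f < 1 by rewrite /f; have := floorD1_gt x; rewrite intrD; lra.
have reduce w : x + (s * w)%:R * theta =
    f + w%:R * e + (Num.floor x + w%:Z * y)%:~R.
  by rewrite /f /e natrM intrD intrM -pmulrn; ring.
have wle (t : R) : 0 <= t -> t <= 1 -> (Num.trunc (t / `|e|) <= 2 * K)%N.
  move=> t0 t1; rewrite -(ler_nat R) natrM -/k.
  apply: le_trans (_ : t / `|e| <= _).
    by have /andP[] := truncn_itv (divr_ge0 t0 (ltW e0)).
  rewrite ler_pdivrMr//; apply: le_trans t1 _.
  by rewrite mulrC -ler_pdivrMr ?mulr_gt0// mul1r.
have [en|ep] := lerP e 0.
  have nE : `|e| = - e by rewrite ler0_norm.
  (* a backward walk stops at the last point before it passes 0 *)
  exists (Num.trunc (f / `|e|)); split.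
    by rewrite addn1 leqW// wle// ltW.
  rewrite reduce frac_ltDint; apply/frac_ltP => //; exists 0.
  have /andP[] := truncn_itv (divr_ge0 f0 (ltW e0)).
  rewrite ler_pdivlMr// ltr_pdivrMr// nE -natr1.
  move: e_le; rewrite nE mulr0z; clear reduce wle; clearbody e f k.
  move: (Num.trunc _)%:R => w h1 h2 h3; apply/andP; split; clear -h1 h2 h3; lra.
have nE : `|e| = e by rewrite gtr0_norm.
have f0' : 0 <= 1 - f by lra.
pose w := Num.trunc ((1 - f) / `|e|).
have wK : (w <= 2 * K)%N by rewrite wle// gerBl.
have /andP[] := truncn_itv (divr_ge0 f0' (ltW e0)); rewrite -/w.
rewrite ler_pdivlMr// ltr_pdivrMr// nE -natr1 => w1 w2.
(* a forward walk stops at the first point at or after 1, and may reach 1 exactly *)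
have [we|we] := eqVneq (w%:R * e) (1 - f).
  exists w; split; first by rewrite addn1 leqW.
  rewrite reduce frac_ltDint we; apply/frac_ltP => //; exists 1.
  by rewrite subrKC mulr1z lexx ltrDl invr_gt0.
have {we}w1 : w%:R * e < 1 - f by rewrite lt_neqAle we.
exists w.+1; split; first by rewrite addn1 ltnS.
rewrite reduce frac_ltDint -natr1; apply/frac_ltP => //; exists 1.
move: e_le; rewrite nE mulr1z; clear reduce wle; clearbody e f k.
move: w1 w2; clear wK; move: w%:R => v h1 h2 h3.
apply/andP; split; clear -h1 h2 h3; lra.
Qed.

(** Each [v] in the first half of the range is sent to a pair made of a hit
[v + s w] and the number [w] of steps leading to it.  The pair determines [v], so the
number of hits times the number of possible [w] is at least half of the range. *)
Lemma hit_count (R : realType) (theta x : R) (K s : nat) (y : int) :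
  (0 < K)%N -> (s <= 34 * K ^ 3)%N ->
  (2 * K%:R)^-1 <= `|s%:R * theta - y%:~R| <= K%:R^-1 ->
  (102 * K ^ 4 <=
   #|[set v : 'I_(204 * K ^ 4) | frac_lt K%:R^-1 (x + v%:R * theta)]%SET|
     * (4 * K))%N.
Proof.
move=> K0 sK hs; set G := [set v | _]%SET.
have swK w : (w <= 2 * K + 1 -> s * w <= 102 * K ^ 4)%N.
  move=> wK; have wK' : (w <= 3 * K)%N by lia.
  by apply: leq_trans (leq_mul sK wK') _; rewrite (expnS _ 3); lia.
have ex (v : 'I_(102 * K ^ 4)) :
    {p : 'I_(204 * K ^ 4) * 'I_(4 * K) | p.1 \in G & p.1 = (v + s * p.2)%N :> nat}.
  apply: cid2; have [w [wK hw]] := shift_hits (x + v%:R * theta) K0 hs.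
  have w4 : (w < 4 * K)%N by lia.
  have v4 : (v + s * w < 204 * K ^ 4)%N by have := ltn_ord v; have := swK _ wK; lia.
  exists (Ordinal v4, Ordinal w4) => //=.
  by rewrite inE /= natrD mulrDl addrA.
pose g v := let: exist2 p _ _ := ex v in p.
have gG v : (g v).1 \in G by rewrite /g; case: (ex v).
have gE v : (g v).1 = (v + s * (g v).2)%N :> nat by rewrite /g; case: (ex v).
have ginj : injective g.
  move=> v v' gv; apply/val_inj/(@addIn (s * (g v).2)%N).
  by rewrite -gE {2}gv -gE gv.
have le : (#|g @: [set: 'I_(102 * K ^ 4)]%SET|
    <= #|finset.setX G [set: 'I_(4 * K)]%SET|)%N.
  apply/subset_leq_card/fintype.subsetP => p /imsetP[v _ ->].
  by case: (g v) (gG v) => a b aG; rewrite finset.in_setX aG inE.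
by move: le; rewrite card_imset// cardsX !cardsT !card_ord.
Qed.

(** * Candidates and greedy hitting sets *)

(** Double counting of the pairs (candidate, test in [U]): the best candidate does
as well as the average one. *)
Lemma best_candidate (W T : finType) (hit : W -> T -> bool) (m : nat)
    (U : {set T}) : (0 < #|W|)%N ->
  (forall t, #|W| <= #|[set w | hit w t]%SET| * m)%N ->
  exists w, (#|U| <= #|[set t in U | hit w t]%SET| * m)%N.
Proof.
move=> W0 hm.
have [//|/forallNP no] := pselect (exists w,
  (#|U| <= #|[set t in U | hit w t]%SET| * m)%N).
exfalso.
have count : (\sum_(t in U) #|[set w | hit w t]%SET| =
    \sum_(w : W) #|[set t in U | hit w t]%SET|)%N.
  transitivity (\sum_(t in U) \sum_(w | hit w t) 1)%N.
    by apply: eq_bigr => t _; rewrite sum1_card; apply: eq_card => w; rewrite inE.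
  rewrite (exchange_big_dep xpredT)//=; apply: eq_bigr => w _.
  by rewrite sum1_card; apply: eq_card => t; rewrite inE.
have lo : (#|U| * #|W| <= \sum_(t in U) #|[set w | hit w t]%SET| * m)%N.
  by rewrite -sum_nat_const; apply: leq_sum.
have hi : (\sum_(w : W) (#|[set t in U | hit w t]%SET| * m + 1) <= #|W| * #|U|)%N.
  rewrite -sum_nat_const; apply: leq_sum => w _.
  by rewrite addn1 ltnNge; apply/negP; exact: no.
move: hi lo; rewrite big_split /= sum1_card -!big_distrl /= count mulnC.
move=> h1; rewrite mulnC => h2.
by have := leq_trans h1 h2; rewrite -[leqRHS]addn0 leq_add2l leqNgt W0.
Qed.

(** Each step picks the candidate that serves the largest part of the tests that
remain, hence at least [1/m] of them. *)
Lemma greedy_hitting (W T : finType) (hit : W -> T -> bool) (m n : nat) :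
  (0 < #|W|)%N -> (forall t, #|W| <= #|[set w | hit w t]%SET| * m)%N ->
  exists2 s : seq W, size s = n &
    (#|[set t | ~~ has (hit^~ t) s]%SET| * m ^ n <= m.-1 ^ n * #|T|)%N.
Proof.
move=> W0 hm; elim: n => [|n [s sn IH]].
  by exists [::] => //; rewrite !expn0 muln1 mul1n max_card.
set U := [set t | _]%SET in IH.
have [w hw] := best_candidate U W0 hm.
exists (w :: s); first by rewrite /= sn.
set U' := [set t | _]%SET.
have UE : (#|U'| + #|[set t in U | hit w t]%SET| = #|U|)%N.
  rewrite addnC -(cardsID [set t | hit w t]%SET U); congr (_ + _)%N; apply: eq_card => t.
    by rewrite !inE andbC.
  by rewrite !inE /= negb_or.
have : (#|U'| * m <= m.-1 * #|U|)%N.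
  case: m hw {hm IH} => [|k] hw /=; first by lia.
  move: UE; nia.
rewrite !expnS => h.
have := leq_mul (leqnn m.-1) IH.
have := leq_mul h (leqnn (m ^ n)).
rewrite -!mulnA; exact: leq_trans.
Qed.

(** With [p = u + 16 K^2 v], the cross term of [p^2 / (16 K^2)^2] is
[u v / (8 K^2)], linear in [v], and the square term in [v] is the integer [v^2]. *)
Definition candidate (K : nat) (o : bool * 'I_(204 * K ^ 4)) : nat :=
  (o.1 + 16 * K ^ 2 * o.2)%N.

Definition quad (R : realType) (K : nat) (b c : R) (p : nat) : R :=
  p%:R ^+ 2 / (16 * K%:R ^+ 2) ^+ 2 + b * p%:R + c.

(** The candidates with the good value of [u] are half of all of them, and
[hit_count] applies to their parameter [v]. *)
Lemma candidate_density (R : realType) (K : nat) (b c : R) : (0 < K)%N ->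
  (#|{: bool * 'I_(204 * K ^ 4)}| <=
   #|[set o : bool * 'I_(204 * K ^ 4) | frac_lt K%:R^-1 (quad K b c (candidate o))]%SET|
     * (16 * K))%N.
Proof.
move=> K0; have [u [s [y [sK hs]]]] := good_slope (b * (16 * K%:R ^+ 2)) K0.
set k : R := K%:R in hs *.
have k0 : k != 0 by rewrite pnatr_eq0 -lt0n.
have := hit_count (u%:R ^+ 2 / (16 * k ^+ 2) ^+ 2 + b * u%:R + c) K0 sK hs.
set G := [set v | _]%SET; set H := [set o | _]%SET => hG.
have GH : (#|G| <= #|H|)%N.
  have <- : #|(fun v => (u, v)) @: G| = #|G| by rewrite card_imset// => v v' [].
  apply/subset_leq_card/fintype.subsetP => _ /imsetP[v + ->].
  rewrite !inE => vG; rewrite -[X in frac_lt _ X]/(quad K b c (candidate (u, v))).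
  rewrite /quad /candidate /= natrD natrM natrM natrX -/k.
  have -> : (u%:R + 16%:R * k ^+ 2 * v%:R) ^+ 2 / (16 * k ^+ 2) ^+ 2 +
      b * (u%:R + 16%:R * k ^+ 2 * v%:R) + c =
    u%:R ^+ 2 / (16 * k ^+ 2) ^+ 2 + b * u%:R + c +
    v%:R * (b * (16 * k ^+ 2) + u%:R * (8 * k ^+ 2)^-1) + (v%:Z ^+ 2)%:~R.
    by rewrite rmorphXn /= -pmulrn; field.
  by rewrite frac_ltDint.
rewrite card_prod card_bool card_ord.
move: hG GH; move: #|G| #|H| => a a'; nia.
Qed.

(** * A small set of integers serving all quadratic polynomials *)

(** The greedy choice may repeat itself, whereas the configuration must have exactly
[n] points; adding points never hurts. *)
Lemma uniq_padding (s : seq nat) :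
  exists ps : seq nat, [/\ size ps = size s, uniq ps & {subset s <= ps}].
Proof.
pose extra := [seq i <- iota 0 (size s) | i \notin undup s].
pose full := undup s ++ extra.
have fullU : uniq full.
  rewrite cat_uniq undup_uniq filter_uniq ?iota_uniq//= andbT.
  by apply/hasPn => i; rewrite mem_filter => /andP[].
have lefull : (size s <= size full)%N.
  rewrite -[leqLHS](size_iota 0); apply: uniq_leq_size; first exact: iota_uniq.
  by move=> i ii; rewrite mem_cat mem_filter ii andbT orbN.
exists (take (size s) full); split; first by rewrite size_takel.
  exact: take_uniq.
move=> i si; rewrite /full take_cat; case: ltnP => h.
  by have := size_undup s; rewrite leqNgt h.
by rewrite mem_cat mem_undup si.
Qed.

(** The error made by rounding [b] down is multiplied by [p], hence the finer grid
for [b]; the same grid point serves all the [p] of bounded size.  The two roundings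
contribute at most [2/K], which enlarges the arc from [1/K] to [3/K]. *)
Lemma quad_rounding (R : realType) (K M : nat) (b c : R) :
  (3 <= K)%N -> (0 < M)%N ->
  exists (i : 'I_M) (j : 'I_K), forall p : nat, (p * K <= M)%N ->
    frac_lt K%:R^-1 (@quad R K (i%:R / M%:R) (j%:R / K%:R) p) ->
    frac_lt (3 / K%:R) (quad K b c p).
Proof.
move=> K3 M0; have K0 : (0 < K)%N by lia.
have round (N : nat) (x : R) : (0 < N)%N ->
    exists i : 'I_N, 0 <= x - (Num.floor x)%:~R - i%:R / N%:R <= N%:R^-1.
  move=> N0; pose f : R := x - (Num.floor x)%:~R.
  have f0 : 0 <= f by rewrite subr_ge0 floor_le.
  have f1 : f < 1 by rewrite /f; have := floorD1_gt x; rewrite intrD; lra.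
  have N0' : 0 < N%:R :> R by rewrite ltr0n.
  have /andP[t1 t2] := truncn_itv (mulr_ge0 f0 (ltW N0')).
  have tN : (Num.trunc (f * N%:R) < N)%N.
    by rewrite -(ltr_nat R); apply: le_lt_trans t1 _; rewrite gtr_pMl.
  exists (Ordinal tN); rewrite -/f /=.
  rewrite subr_ge0 ler_pdivrMr// t1 /= lerBlDr -[X in _ <= X + _]mul1r -mulrDl
    nat1r ler_pdivlMr//.
  by rewrite ltW.
have [i /andP[i0 i1]] := round M b M0; have [j /andP[j0 j1]] := round K c K0.
exists i, j => p pM.
have k0 : 0 < K%:R :> R by rewrite ltr0n.
have kinv : K%:R^-1 <= 1 / 3 :> R.
  by rewrite div1r lef_pV2 ?posrE// ler_nat.
have kinv0 : 0 < K%:R^-1 :> R by rewrite invr_gt0.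
have pM' : p%:R * M%:R^-1 <= K%:R^-1 :> R.
  by rewrite ler_pdivrMr ?ltr0n// mulrC ler_pdivlMr// -natrM ler_nat.
have p0 : 0 <= p%:R :> R by [].
have dp0 := mulr_ge0 i0 p0.
have dp1 : (b - (Num.floor b)%:~R - i%:R / M%:R) * p%:R <= K%:R^-1.
  by apply: le_trans pM'; rewrite [leRHS]mulrC ler_wpM2r.
case/frac_ltP => [|z /andP[z0 z1]]; first lra.
apply/frac_ltP; first by rewrite ler_pdivrMr// mul1r ler_nat.
exists (z + Num.floor b * p%:Z + Num.floor c).
move: z0 z1; rewrite /quad !intrD intrM -pmulrn.
move: dp0 dp1 j0 j1 kinv0; clear.
move: (Num.floor b)%:~R (Num.floor c)%:~R => fb fc.
move: (_ / (16 * _) ^+ 2) (i%:R / _) (j%:R / _) => A ib jc.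
move: p%:R z%:~R (K%:R^-1) => P Z k *; apply/andP; split; lra.
Qed.

(** The hypothesis says that after [n] greedy steps fewer than one test remains;
there are [3264 K^7] grid values for [b] and [K] for [c]. *)
Lemma universal_hitting (R : realType) (K n : nat) : (3 <= K)%N ->
  ((16 * K).-1 ^ n * (3264 * K ^ 8) < (16 * K) ^ n)%N ->
  exists ps : seq nat, [/\ size ps = n, uniq ps &
    forall b c : R, has (fun p => frac_lt (3 / K%:R) (quad K b c p)) ps].
Proof.
move=> K3 small; have K0 : (0 < K)%N by lia.
pose M := (3264 * K ^ 7)%N.
have M0 : (0 < M)%N by have : (0 < K ^ 7)%N; [rewrite expn_gt0 K0|rewrite /M; lia].
pose hit (o : bool * 'I_(204 * K ^ 4)) (t : 'I_M * 'I_K) :=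
  frac_lt K%:R^-1 (@quad R K (t.1%:R / M%:R) (t.2%:R / K%:R) (candidate o)).
have W0 : (0 < #|{: bool * 'I_(204 * K ^ 4)}|)%N.
  have : (0 < K ^ 4)%N by rewrite expn_gt0 K0.
  by rewrite card_prod card_bool card_ord; lia.
have [s sn] := @greedy_hitting _ _ hit (16 * K) n W0
  (fun t => candidate_density (t.1%:R / M%:R : R) (t.2%:R / K%:R) K0).
rewrite card_prod !card_ord => hs.
have {hs} all_hit t : has (hit^~ t) s.
  apply: contraLR hs => nt; rewrite -ltnNge.
  have MK : (M * K = 3264 * K ^ 8)%N by rewrite /M -mulnA -expnSr.
  rewrite MK; apply: leq_trans small _; rewrite leq_pmull//.
  by apply/card_gt0P; exists t; rewrite inE.
have [ps [psn psU sub]] := uniq_padding [seq candidate o | o <- s].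
exists ps; split => //; first by rewrite psn size_map.
move=> b c.
have bound (o : bool * 'I_(204 * K ^ 4)) : (candidate o * K <= M)%N.
  rewrite /candidate /M; case: o => u v /=.
  have h : (u + 16 * K ^ 2 * v <= 3264 * K ^ 6)%N.
    have : (1 <= K ^ 2)%N by rewrite expn_gt0 K0.
    have : (K ^ 6 = K ^ 2 * K ^ 4)%N by rewrite -expnD.
    have := ltn_ord v; have : (u <= 1)%N by case: (u).
    move: (nat_of_ord v) (nat_of_bool u) => a e.
    by move: (K ^ 2)%N (K ^ 4)%N (K ^ 6)%N => k2 k4 k6; nia.
  by rewrite (expnSr _ 6) mulnA leq_mul2r h orbT.
have [i [j hround]] := quad_rounding b c K3 M0.
have /hasP[w ws hw] := all_hit (i, j).
apply/hasP; exists (candidate w); first by apply/sub/map_f.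
exact: hround hw.
Qed.

(** * The choice of the scale *)

Lemma ln_le_subr1 (R : realType) (x : R) : 0 < x -> ln x <= x - 1.
Proof. by move=> x0; rewrite -{1}(subrKC 1 x) le_ln1Dx//; lra. Qed.

Lemma ln_le_sqrt (R : realType) (x : R) : 0 < x -> ln x <= 2 * Num.sqrt x.
Proof.
move=> x0; have s0 : 0 < Num.sqrt x by rewrite sqrtr_gt0.
have -> : ln x = 2 * ln (Num.sqrt x).
  by rewrite -[in LHS](sqr_sqrtr (ltW x0)) lnXn// mulr_natl.
have := ln_le_subr1 s0; lra.
Qed.

Lemma ln_ge_half (R : realType) (x : R) : 2 <= x -> 1 / 2 <= ln x.
Proof.
move=> x2; have x0 : 0 < x by lra.
have : ln x^-1 <= x^-1 - 1 by apply: ln_le_subr1; rewrite invr_gt0.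
rewrite lnV ?posrE//.
have : x^-1 <= 2^-1 by rewrite lef_pV2 ?posrE.
lra.
Qed.

(** [(1 - 1/(16K))^n <= exp (- n/(16K)) <= n^-9], while [a K^8 < n^9]. *)
Lemma greedy_terminates (R : realType) (a K n : nat) : (0 < K)%N -> (a < n)%N ->
  (K <= n)%N -> 144 * K%:R * ln n%:R <= n%:R :> R ->
  ((16 * K).-1 ^ n * (a * K ^ 8) < (16 * K) ^ n)%N.
Proof.
move=> K0 an Kn hK; have n0 : (0 < n)%N by apply: leq_trans an.
pose m : R := 16 * K%:R.
have m0 : 0 < m by rewrite mulr_gt0// ltr0n.
have n9 : 0 < n%:R ^+ 9 :> R by rewrite exprn_gt0// ltr0n.
have mE : (16 * K).-1%:R = m * (1 - m^-1).
  have : (0 < 16 * K)%N by rewrite muln_gt0.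
  by rewrite mulrBr mulr1 divff ?gt_eqF// -subn1 => h; rewrite natrB// natrM.
have e1 : (1 - m^-1) ^+ n <= (n%:R ^+ 9)^-1.
  have : (1 - m^-1) ^+ n <= expR (- m^-1) ^+ n.
    rewrite lerXn2r ?nnegrE ?expR_ge0 ?expR_ge1Dx//.
    by rewrite subr_ge0 invf_le1// /m -natrM ler1n muln_gt0.
  move/le_trans; apply; rewrite -expRM_natl.
  have -> : (n%:R ^+ 9)^-1 = expR (- (9 * ln n%:R)) :> R.
    by rewrite expRN expRM_natl lnK// posrE ltr0n.
  rewrite ler_expR mulrN lerN2 ler_pdivlMr//.
  by apply: le_trans hK; rewrite /m; lra.
have e2 : (a * K ^ 8)%:R < n%:R ^+ 9 :> R.
  rewrite natrM natrX (exprS _ 8); apply: (@le_lt_trans _ _ (a%:R * n%:R ^+ 8)).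
    by rewrite ler_wpM2l// lerXn2r ?nnegrE// ler_nat.
  by rewrite ltr_pM2r ?exprn_gt0 ?ltr0n// ltr_nat.
rewrite -(ltr_nat R) natrM !natrX mE exprMn -mulrA.
rewrite [(16 * K)%:R]natrM -/m -[ltRHS]mulr1.
rewrite ltr_pM2l ?exprn_gt0//.
apply: (@le_lt_trans _ _ ((n%:R ^+ 9)^-1 * (a * K ^ 8)%:R)); first by rewrite ler_wpM2r.
by rewrite mulrC ltr_pdivrMr// mul1r.
Qed.

(** [K] is the integer part of [n / (144 ln n)]; [144 = 16 * 9] makes the failure
bound [n^-9], which beats the [O(n^8)] tests. *)
Lemma scale_choice (R : realType) (n : nat) : 864 <= Num.sqrt n%:R :> R ->
  exists K : nat, [/\ (3 <= K)%N,
    ((16 * K).-1 ^ n * (3264 * K ^ 8) < (16 * K) ^ n)%N &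
    3 / K%:R <= 864 * (ln n%:R / n%:R) :> R].
Proof.
move=> hn; set x : R := n%:R in hn *.
have s0 : 0 < Num.sqrt x by lra.
have x0 : 0 < x by move: s0; rewrite sqrtr_gt0.
have xE : x = Num.sqrt x * Num.sqrt x by rewrite -expr2 sqr_sqrtr// ltW.
have big : 864 * Num.sqrt x <= x by rewrite [leRHS]xE ler_pM2r.
have x2 : 3264 < x by lra.
have L0 : 1 / 2 <= ln x by apply: ln_ge_half; lra.
have Lx : 432 * ln x <= x by have := ln_le_sqrt x0; lra.
have d0 : 0 < 144 * ln x by lra.
have X3 : 3 <= x / (144 * ln x) by rewrite ler_pdivlMr//; lra.
have X0 : 0 <= x / (144 * ln x) by lra.
exists (Num.trunc (x / (144 * ln x))).
have /andP[t1 t2] := truncn_itv X0.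
set K := Num.trunc _ in t1 t2 *.
have K3 : (3 <= K)%N by rewrite -ltnS -(ltr_nat R); apply: le_lt_trans t2; lra.
have K3' : 3 <= K%:R :> R by rewrite (ler_nat R 3).
have KL : K%:R * (144 * ln x) <= x by rewrite -ler_pdivlMr.
split => //.
- apply: (@greedy_terminates R); first by apply: leq_trans K3.
  + by rewrite -(ltr_nat R).
  + rewrite -(ler_nat R); apply: le_trans t1 _.
    by rewrite ler_pdivrMr// ler_peMr ?ltW//; lra.
  + by apply: le_trans KL; rewrite -/x; lra.
- have : x < (K%:R + 1) * (144 * ln x) by rewrite -ltr_pdivrMr// natr1.
  rewrite ler_pdivrMr; last lra.
  have -> : 864 * (ln x / x) * K%:R = 864 * ln x * K%:R / x by ring.
  rewrite ler_pdivlMr// => h.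
  have : 0 <= (K%:R - 3) * ln x by rewrite mulr_ge0//; lra.
  lra.
Qed.

(** * The set of reals whose shifted square has small fractional part *)

Lemma measurable_frac_lt (R : realType) (l : R) : l <= 1 ->
  measurable [set x : measurableTypeR R | frac_lt l x].
Proof.
move=> l1.
have -> : [set x : measurableTypeR R | frac_lt l x] =
    \bigcup_(z in [set: int]) `[z%:~R : R, z%:~R + l[%classic.
  apply/seteqP; split => [x /frac_ltP/= /(_ l1)[z zx]|x [z _] /= zx].
    by exists z => //=; rewrite in_itv.
  by apply/frac_ltP => //; exists z; rewrite in_itv in zx.
apply: countable_bigcupT_measurable => [|z]; first exact: countableP.
exact: measurable_itv.
Qed.

Lemma measure_itvcc (R : realType) (a b : R) : a <= b ->
  @lebesgue_measure R `[a, b]%classic = (b - a)%:E.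
Proof.
move=> ab; have := @lebesgue_measure_itv R `[a, b]; rewrite /= lte_fin => ->.
by case: ltP => // ba; have -> : a = b by [apply/le_anti; rewrite ab]; rewrite subrr.
Qed.

Definition sqr_lt (R : realType) (X : R) : set (measurableTypeR R) :=
  [set x | x ^+ 2 < X].

Lemma measurable_sqr_lt (R : realType) (X : R) : measurable (sqr_lt X).
Proof.
have -> : sqr_lt X = (fun x => x ^+ 2) @^-1` `]-oo, X[.
  by apply/seteqP; split => x /=; rewrite in_itv.
by rewrite -[X in measurable X]setTI; apply: exprn_measurable.
Qed.

Lemma measure_sqr_lt (R : realType) (X : R) :
  (@lebesgue_measure R (sqr_lt X) <= (2 * Num.sqrt X)%:E)%E.
Proof.
have sub : sqr_lt X `<=` `[- Num.sqrt X, Num.sqrt X].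
  move=> x /= xX; rewrite in_itv /= -ler_norml -sqrtr_sqr.
  by rewrite ler_wsqrtr// ltW.
apply: le_trans (le_measure (@lebesgue_measure R) _ _ sub) _; rewrite ?inE.
- exact: measurable_sqr_lt.
- exact: measurable_itv.
have := sqrtr_ge0 X => r0.
by rewrite [leLHS]measure_itvcc ?lee_fin//; lra.
Qed.

(** Concavity of the square root: on [X, X + l] it grows by at most [l] times its
growth over the unit interval that ends at [X]. *)
Lemma sqrt_increment (R : realType) (l X : R) : 0 <= l -> 1 <= X ->
  Num.sqrt (X + l) - Num.sqrt X <= l * (Num.sqrt X - Num.sqrt (X - 1)).
Proof.
move=> l0 X1.
set a := Num.sqrt (X + l); set b := Num.sqrt X; set c := Num.sqrt (X - 1).
have a2 : a ^+ 2 = X + l by rewrite sqr_sqrtr//; lra.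
have b2 : b ^+ 2 = X by rewrite sqr_sqrtr//; lra.
have c2 : c ^+ 2 = X - 1 by rewrite sqr_sqrtr//; lra.
have b0 : 0 < b by rewrite sqrtr_gt0; lra.
have c0 : 0 <= c by exact: sqrtr_ge0.
have cb : c <= b by rewrite ler_wsqrtr//; lra.
have ba : b <= a by rewrite ler_wsqrtr//; lra.
have e1 : (a - b) * (a + b) = l by rewrite -subr_sqr a2 b2; lra.
have e2 : (b - c) * (b + c) = 1 by rewrite -subr_sqr b2 c2; lra.
have h : 0 <= (a - b) * (b - c) * (a - c) by rewrite !mulr_ge0 ?subr_ge0//; lra.
rewrite -[leLHS]mulr1 -[X in _ * X]e2 -e1 -subr_ge0.
by rewrite (_ : _ - _ = (a - b) * (b - c) * (a - c))//; ring.
Qed.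


(** In the annulus [X <= x^2 < X + 1], where [x^2 + s] stays between two consecutive
integers, the condition on the fractional part cuts out two intervals. *)
Lemma sqr_slab (R : realType) (l s X x : R) (z : int) : l <= 1 -> 0 <= l ->
  0 <= X -> X + s = z%:~R -> frac_lt l (x ^+ 2 + s) -> X <= x ^+ 2 < X + 1 ->
  (`[- Num.sqrt (X + l), - Num.sqrt X] `|` `[Num.sqrt X, Num.sqrt (X + l)])%classic x.
Proof.
move=> l1 l0 X0 Xz /(frac_ltP _ l1)[y /andP[yx xy]] /andP[Xx xX].
have yz : y = z.
  have h1 : y < z + 1 by rewrite -(ltr_int R) intrD; lra.
  have h2 : z < y + 1 by rewrite -(ltr_int R) intrD; lra.
  by lia.
subst y.
have u1 : Num.sqrt X <= `|x| by rewrite -sqrtr_sqr ler_wsqrtr.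
have u2 : `|x| <= Num.sqrt (X + l) by rewrite -sqrtr_sqr ler_wsqrtr//; lra.
have [x0|x0] := lerP 0 x; [right|left]; rewrite /= in_itv /=.
  by rewrite ger0_norm// in u1 u2; rewrite u1.
by rewrite ltr0_norm// in u1 u2; apply/andP; split; lra.
Qed.

Definition frac_sqr (R : realType) (l s : R) : set (measurableTypeR R) :=
  [set x | frac_lt l (x ^+ 2 + s)].

Lemma measurable_frac_sqr (R : realType) (l s : R) : l <= 1 ->
  measurable (frac_sqr l s).
Proof.
move=> l1; rewrite -[X in measurable X]setTI.
have mf : measurable_fun setT (fun x : measurableTypeR R => x ^+ 2 + s : measurableTypeR R).
  by apply: measurable_funD => //; exact: exprn_measurable.
exact: (mf measurableT [set x | frac_lt l x] (measurable_frac_lt l1)).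
Qed.

(** The right-hand side is chosen to telescope over [X], [X + 1], ... *)
Lemma frac_sqr_step (R : realType) (l s X : R) (z : int) :
  0 <= l -> l <= 1 -> 1 <= X -> X + s = z%:~R ->
  (@lebesgue_measure R (frac_sqr l s `&` sqr_lt (X + 1)%R) <=
   @lebesgue_measure R (frac_sqr l s `&` sqr_lt X) +
     (2 * l * (Num.sqrt X - Num.sqrt (X - 1)))%:E)%E.
Proof.
move=> l0 l1 X1 Xz; set A := frac_sqr l s; pose B := @sqr_lt R.
have mA : measurable A by exact: measurable_frac_sqr.
have mB Y : measurable (B Y) by exact: measurable_sqr_lt.
pose S1 := `[- Num.sqrt (X + l), - Num.sqrt X]%classic : set (measurableTypeR R).
pose S2 := `[Num.sqrt X, Num.sqrt (X + l)]%classic : set (measurableTypeR R).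
have mS1 : measurable S1 by exact: measurable_itv.
have mS2 : measurable S2 by exact: measurable_itv.
have sub : A `&` B (X + 1) `<=` (A `&` B X) `|` (S1 `|` S2).
  move=> x [Ax Bx]; have [xX|Xx] := ltP (x ^+ 2) X; first by left.
  by right; apply: (sqr_slab l1 l0 _ Xz Ax); [lra | rewrite Xx].
have XlX : Num.sqrt X <= Num.sqrt (X + l) by rewrite ler_wsqrtr//; lra.
apply: le_trans (le_measure (@lebesgue_measure R) _ _ sub) _; rewrite ?inE.
- exact: measurableI.
- by apply: measurableU; [exact: measurableI | exact: measurableU].
apply: le_trans (measureU2 _ _ _) _.
- exact: measurableI.
- exact: measurableU.
apply: leeD => //.
apply: le_trans (measureU2 _ _ _) _ => //.
rewrite [X in (X + _)%E]measure_itvcc ?lerN2// [X in (_ + X)%E]measure_itvcc//.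
rewrite -EFinD lee_fin; have := sqrt_increment l0 X1; lra.
Qed.

(** What matters is that the error [8] depends neither on [s] nor on [T]: [s]
carries the other coordinates when this bound is used on slices.  The radii are
the square roots of [X0 + m], where [1 <= X0 <= 2] and [X0 + s] is an
integer, and the telescoping sum is at most [2 l] times the last radius. *)
Lemma frac_sqr_measure (R : realType) (l s T : R) : 0 <= l -> l <= 1 -> 0 <= T ->
  (@lebesgue_measure R (frac_sqr l s `&` `[(- T)%R, T]%classic) <= (l * (2 * T) + 8)%:E)%E.
Proof.
move=> l0 l1 T0.
pose A := frac_sqr l s; pose B := @sqr_lt R.
have mA : measurable A by exact: measurable_frac_sqr.
have mB Y : measurable (B Y) by exact: measurable_sqr_lt.
pose X0 : R := (Num.floor s + 2)%:~R - s.
have X01 : 1 <= X0 <= 2.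
  rewrite /X0 intrD; have := floor_le s; have := floorD1_gt s; rewrite intrD => ? ?.
  apply/andP; split; lra.
have /andP[X0ge X0le] := X01.
have bound m : (@lebesgue_measure R (A `&` B (X0 + m%:R)%R) <=
    (4 + 2 * l * Num.sqrt (X0 + m%:R - 1))%:E)%E.
  elim: m => [|m IH].
    apply: le_trans (le_measure (@lebesgue_measure R) _ _ (@subIsetr _ A (B (X0 + 0%:R)))) _.
    - by rewrite inE; exact: measurableI.
    - by rewrite inE.
    apply: le_trans (measure_sqr_lt _) _.
    rewrite addr0 lee_fin.
    have h1 : Num.sqrt X0 <= 2.
      have -> : 2 = Num.sqrt (2 ^+ 2) :> R by rewrite sqrtr_sqr ger0_norm.
      by rewrite ler_wsqrtr// expr2; lra.
    have := mulr_ge0 l0 (sqrtr_ge0 (X0 - 1)); lra.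
  have E : X0 + m.+1%:R = X0 + m%:R + 1 by rewrite -natr1 addrA.
  have Xm : 1 <= X0 + m%:R by have : 0 <= m%:R :> R by []; lra.
  have Xz : X0 + m%:R + s = (Num.floor s + 2 + m%:Z)%:~R.
    by rewrite /X0 !intrD -pmulrn; ring.
  rewrite E; apply: le_trans (frac_sqr_step l0 l1 Xm Xz) _.
  apply: le_trans (leeD2r _ IH) _.
  rewrite -EFinD lee_fin addrK; lra.
pose m := (Num.trunc (T ^+ 2)).+1.
have T20 := sqr_ge0 T.
have /andP[tm1 tm2] := truncn_itv T20.
have sub : A `&` `[- T, T]%classic `<=` A `&` B (X0 + m%:R).
  move=> x [Ax]; rewrite /= in_itv /= -ler_norml => xT; split => //=.
  have : x ^+ 2 <= T ^+ 2 by rewrite -real_normK ?num_real// lerXn2r// nnegrE.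
  move=> /le_lt_trans; apply; apply: lt_le_trans tm2 _.
  by rewrite lerDr; lra.
apply: le_trans (le_measure (@lebesgue_measure R) _ _ sub) _; rewrite ?inE.
- by apply: measurableI => //; exact: measurable_itv.
- exact: measurableI.
apply: le_trans (bound m) _; rewrite lee_fin.
have : Num.sqrt (X0 + m%:R - 1) <= T + 2.
  have -> : T + 2 = Num.sqrt ((T + 2) ^+ 2) by rewrite sqrtr_sqr ger0_norm//; lra.
  rewrite ler_wsqrtr// /m -natr1 sqrrD; lra.
move=> /(ler_wpM2l l0); lra.
Qed.

(** * Slicing in higher dimension *)

(** The shift [s] makes this family stable under slicing. *)
Definition frac_sqnorm (R : realType) (d : nat) (l s : R) :
    set (d.-tuple (measurableTypeR R)) :=
  [set t | frac_lt l (\sum_(x <- t) x ^+ 2 + s)].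

Definition tuple_cube (R : realType) (d : nat) (T : R) :
    set (d.-tuple (measurableTypeR R)) :=
  [set t | all (fun x => - T <= x <= T) t].

Lemma measurable_frac_sqnorm (R : realType) (d : nat) (l s : R) : l <= 1 ->
  measurable (@frac_sqnorm R d l s).
Proof.
move=> l1; rewrite -[X in measurable X]setTI.
pose f (t : d.-tuple (measurableTypeR R)) : measurableTypeR R :=
  \sum_(x <- t) x ^+ 2 + s.
have mf : measurable_fun setT f.
  apply: measurable_funD => //.
  rewrite (_ : (fun t : d.-tuple (measurableTypeR R) => _) =
    (fun t => \sum_(i <- enum 'I_d) tnth t i ^+ 2 : R)).
    apply: measurable_sum => i; apply: measurable_funX; exact: measurable_tnth.
  by apply/funext => t; rewrite big_tuple big_enum.
exact: (mf measurableT [set x | frac_lt l x] (measurable_frac_lt l1)).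
Qed.

Lemma measurable_tuple_cube (R : realType) (d : nat) (T : R) :
  measurable (@tuple_cube R d T).
Proof.
rewrite (_ : tuple_cube T = \bigcap_(i in [set: 'I_d])
    ((fun t : d.-tuple (measurableTypeR R) => tnth t i) @^-1` `[- T, T])).
  apply: fin_bigcap_measurable => // i _.
  rewrite -[X in measurable X]setTI.
  have mi : measurable (`[- T, T]%classic : set (measurableTypeR R)).
    exact: measurable_itv.
  have mt : measurable_fun setT (fun t : d.-tuple (measurableTypeR R) => tnth t i).
    exact: measurable_tnth.
  exact: (mt measurableT _ mi).
apply/seteqP; split => t /=.
  by move=> /all_tnthP h i _ /=; rewrite in_itv; exact: h.
by move=> h; apply/all_tnthP => i; have := h i Logic.I; rewrite /= in_itv.
Qed.

Lemma lebesgue_tuple_cube (R : realType) (d : nat) (T : R) : 0 <= T ->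
  lebesgue_tuple (@tuple_cube R d T) = ((2 * T) ^+ d)%:E.
Proof.
move=> T0; elim: d => [|d IH].
  by rewrite expr0 /= diracE mem_set.
rewrite /= /pushforward (_ : _ @^-1` _ = `[- T, T]%classic `*` tuple_cube T).
  rewrite product_measure1E//; last exact: measurable_tuple_cube.
  rewrite [X in (_ * X)%E]IH [X in (X * _)%E]measure_itvcc; last lra.
  by rewrite -EFinM exprS; congr (_ * _)%:E; lra.
apply/seteqP; split => -[x t]; rewrite /cons_pair /tuple_cube /= in_itv /=.
  by move=> /andP[].
by move=> [-> ->].
Qed.

(** The integral form keeps the measure on the remaining coordinates folded, so
that its canonical measure structure is found. *)
Lemma lebesgue_tupleS (R : realType) (d : nat)
    (A : set (d.+1.-tuple (measurableTypeR R))) :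
  lebesgue_tuple A =
    (\int[@lebesgue_measure R]_x
      (@lebesgue_tuple R d \o xsection (@cons_pair R d @^-1` A)) x)%E.
Proof. by []. Qed.

(** Fubini bound: the first coordinate ranges over an interval of length [2 T]. *)
Lemma lebesgue_tuple_slices (R : realType) (d : nat) (T C : R)
    (A : set (d.+1.-tuple (measurableTypeR R))) :
  0 <= T -> 0 <= C -> measurable A ->
  (forall x : R, - T <= x <= T ->
    (lebesgue_tuple [set t | A (cons_pair (x, t))] <= C%:E)%E) ->
  (forall t, A t -> - T <= thead t <= T) ->
  (lebesgue_tuple A <= (2 * T * C)%:E)%E.
Proof.
move=> T0 C0 mA slice_le slice0.
pose D : set (measurableTypeR R) := `[- T, T]%classic.
have mD : measurable D by exact: measurable_itv.
have mA' : measurable (@cons_pair R d @^-1` A).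
  by rewrite -[X in measurable X]setTI; exact: measurable_cons_pair.
have -> : ((2 * T * C)%:E = \int[@lebesgue_measure R]_(x in D) cst C%:E x)%E.
  rewrite integral_cst// [X in (_ * X)%E]measure_itvcc; last lra.
  by rewrite -EFinM; congr (_%:E); ring.
rewrite [leRHS]integral_mkcond lebesgue_tupleS.
apply: ge0_le_integral => //.
- exact: (measurable_fun_xsection (@lebesgue_tuple R d) mA').
- exact: (proj1 (measurable_restrictT _ mD) (measurable_cst _)).
move=> x _; have [xD|xD] := boolP (x \in D).
  rewrite patchE xD /=.
  have -> : xsection (@cons_pair R d @^-1` A) x = [set t | A (cons_pair (x, t))].
    by apply/seteqP; split => t; rewrite /xsection /= inE.
  by apply: slice_le; move: xD; rewrite inE /D /= in_itv.
rewrite patchE (negbTE xD) /=.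
have -> : xsection (@cons_pair R d @^-1` A) x = set0.
  rewrite -subset0 => t; rewrite /xsection /= inE => /slice0 xT.
  by move/negP: xD; apply; rewrite inE /D /= in_itv.
by rewrite measure0.
Qed.

(** The slice at first coordinate [x] is the same set in one dimension less, with
shift [s + x^2], so the uniformity in [s] carries the induction. *)
Lemma frac_sqnorm_measure (R : realType) (d : nat) (l s T : R) :
  0 <= l -> l <= 1 -> 0 <= T ->
  (lebesgue_tuple (@frac_sqnorm R d.+1 l s `&` tuple_cube T) <=
   ((2 * T) ^+ d * (l * (2 * T) + 8))%:E)%E.
Proof.
move=> l0 l1 T0; elim: d s => [|d IH] s.
  rewrite expr0 mul1r; apply: le_trans (frac_sqr_measure s l0 l1 T0).
  have mE : measurable (frac_sqr l s `&` `[- T, T]).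
    by apply: measurableI; [exact: measurable_frac_sqr|exact: measurable_itv].
  set S := frac_sqr l s `&` _ in mE *.
  have -> : (@lebesgue_measure R S = \int[@lebesgue_measure R]_x (\1_S x)%:E)%E.
    by rewrite integral_indic// setIT.
  rewrite lebesgue_tupleS.
  rewrite le_eqVlt; apply/orP; left; apply/eqP; apply: eq_integral => x _ /=.
  rewrite diracE indicE; congr ((nat_of_bool _)%:R%:E).
  apply/idP/idP; rewrite !inE /xsection /= inE /S /frac_sqnorm /tuple_cube /frac_sqr /=.
    by rewrite big_seq1 in_itv /= andbT.
  by rewrite big_seq1 in_itv /= andbT.
have C0 : 0 <= (2 * T) ^+ d * (l * (2 * T) + 8).
  by rewrite mulr_ge0// ?exprn_ge0 ?addr_ge0 ?mulr_ge0.
rewrite exprS -mulrA; apply: lebesgue_tuple_slices => //.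
- by apply: measurableI; [exact: measurable_frac_sqnorm|exact: measurable_tuple_cube].
- move=> x xT; rewrite (_ : [set t | _] =
      frac_sqnorm l (s + x ^+ 2) `&` tuple_cube T); first exact: IH.
  apply/seteqP; split => t; rewrite /frac_sqnorm /tuple_cube /= xT big_cons /=.
    by rewrite [x ^+ 2 + _]addrC -addrA [x ^+ 2 + s]addrC.
  by rewrite [x ^+ 2 + _]addrC -addrA [x ^+ 2 + s]addrC.
- move=> t [_]; rewrite /tuple_cube /= => /all_tnthP; exact.
Qed.

(** * The density of the complement of the shells *)

Definition sqnorm (R : realType) (d : nat) (x : 'rV[R]_d) : R := \sum_i x 0 i ^+ 2.

Definition frac_shells (R : realType) (d : nat) (l : R) : set 'rV[R]_d :=
  [set x | frac_lt l (sqnorm x)].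

(** The complement of an arc is an arc: [frac x >= l] exactly when
[frac (x - l) < 1 - l].  This is what turns upper bounds into lower bounds. *)
Lemma frac_ltN (R : realType) (l x : R) : 0 <= l -> l <= 1 ->
  ~~ frac_lt l x = frac_lt (1 - l) (x - l).
Proof.
move=> l0 l1; apply/idP/idP.
  rewrite /frac_lt -leNgt => h; apply/frac_ltP; first lra.
  exists (Num.floor x); have := floorD1_gt x; rewrite intrD => ?.
  by apply/andP; split; lra.
move=> /(frac_ltP (x - l))[|z /andP[zx xz]]; first lra.
rewrite /frac_lt -leNgt (@floor_def _ x z); first lra.
by rewrite intrD; apply/andP; split; lra.
Qed.

Lemma preimage_shellsC (R : realType) (d : nat) (l : R) : 0 <= l -> l <= 1 ->
  @row_of_tuple R d @^-1` (~` frac_shells l) = frac_sqnorm (1 - l) (- l).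
Proof.
move=> l0 l1; have sq t : sqnorm (row_of_tuple t) = \sum_(x <- t) x ^+ 2 :> R.
  by rewrite big_tuple; apply: eq_bigr => i _; rewrite mxE.
apply/seteqP; split => t; rewrite /frac_sqnorm /frac_shells /= sq.
  by move=> /negP; rewrite frac_ltN.
by rewrite -frac_ltN// => /negP.
Qed.

Lemma preimage_cube (R : realType) (d : nat) (s : R) :
  @row_of_tuple R d @^-1` (cube s) = tuple_cube (s / 2).
Proof.
apply/seteqP; split => t; rewrite /tuple_cube /cube /=.
  by move=> h; apply/all_tnthP => i; have := h i; rewrite mxE.
by move=> /all_tnthP h i; rewrite mxE; exact: h.
Qed.

Lemma lebesgue_measurable_borel (R : realType) (d : nat) (E : set 'rV[R]_d) :
  measurable (@row_of_tuple R d @^-1` E) -> lebesgue_measurable E.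
Proof.
by move=> mE; apply: sub_caratheodory; exact: sub_sigma_algebra.
Qed.

Lemma shellsC_measurable (R : realType) (d : nat) (l : R) : 0 <= l -> l <= 1 ->
  @lebesgue_measurable R d (~` frac_shells l).
Proof.
move=> l0 l1; apply: lebesgue_measurable_borel.
by rewrite preimage_shellsC//; apply: measurable_frac_sqnorm; lra.
Qed.

(** The upper bound holds for the set and for its complement in the cube, whose
volumes add up to that of the cube; so both are sharp up to [8 s^d]. *)
Lemma vol_shellsC_cube (R : realType) (d : nat) (l s : R) :
  0 <= l -> l <= 1 -> 0 < s ->
  exists2 v : R, lebesgue_vol (~` @frac_shells R d.+1 l `&` cube s) = v%:E &
    `|v / s ^+ d.+1 - (1 - l)| <= 8 / s.
Proof.
move=> l0 l1 s0; have T0 : 0 <= s / 2 by lra.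
set mu := @lebesgue_tuple R d.+1.
pose Q := @tuple_cube R d.+1 (s / 2).
pose A := @frac_sqnorm R d.+1 l 0.
pose B := @frac_sqnorm R d.+1 (1 - l) (- l).
have mQ : measurable Q by exact: measurable_tuple_cube.
have mA : measurable A by exact: measurable_frac_sqnorm.
have mB : measurable B by apply: measurable_frac_sqnorm; lra.
have AB : ~` A = B.
  apply/seteqP; split => t; rewrite /A /B /frac_sqnorm /= addr0.
    by move=> /negP; rewrite frac_ltN.
  by rewrite -frac_ltN// => /negP.
have volE : lebesgue_vol (~` @frac_shells R d.+1 l `&` cube s) = mu (B `&` Q).
  rewrite /lebesgue_vol preimage_setI preimage_shellsC// preimage_cube.
  by rewrite measurable_mu_extE//; exact: measurableI.
have muQ : mu Q = (s ^+ d.+1)%:E.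
  by rewrite /mu lebesgue_tuple_cube//; congr (_ ^+ _)%:E; lra.
have two_half : 2 * (s / 2) = s by lra.
have leA : (mu (A `&` Q) <= (s ^+ d * (l * s + 8))%:E)%E.
  by have := frac_sqnorm_measure d 0 l0 l1 T0; rewrite two_half.
have leB : (mu (B `&` Q) <= (s ^+ d * ((1 - l) * s + 8))%:E)%E.
  by have := @frac_sqnorm_measure R d (1 - l) (- l) (s / 2); rewrite two_half; apply; lra.
have split_Q : (mu Q = mu (A `&` Q) + mu (B `&` Q))%E.
  have {1}-> : Q = (A `&` Q) `|` (B `&` Q) by rewrite -setIUl -AB setUv setTI.
  apply: (@measureU _ _ _ (@lebesgue_tuple R d.+1)).
  - exact: measurableI.
  - exact: measurableI.
  - by rewrite setIACA -AB setICr set0I.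
have finA : mu (A `&` Q) \is a fin_num.
  by rewrite ge0_fin_numE ?measure_ge0// (le_lt_trans leA)// ltry.
have finB : mu (B `&` Q) \is a fin_num.
  by rewrite ge0_fin_numE ?measure_ge0// (le_lt_trans leB)// ltry.
exists (fine (mu (B `&` Q))); first by rewrite volE fineK.
move: leA leB split_Q; rewrite muQ -(fineK finA) -(fineK finB) -EFinD !lee_fin /=.
move: (fine _) (fine _) => b a leA leB [ab].
have sd : 0 < s ^+ d by exact: exprn_gt0.
rewrite exprS in ab *.
have -> : b / (s * s ^+ d) - (1 - l) = (b - (1 - l) * (s * s ^+ d)) / (s * s ^+ d).
  by field; rewrite !gt_eqF.
rewrite normrM normfV (gtr0_norm (mulr_gt0 s0 sd)).
rewrite ler_pdivrMr ?mulr_gt0//.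
have -> : 8 / s * (s * s ^+ d) = 8 * s ^+ d by field; rewrite gt_eqF.
by rewrite ler_norml; apply/andP; split; lra.
Qed.

Lemma shellsC_density (R : realType) (d : nat) (l : R) : 0 <= l -> l <= 1 ->
  has_density (~` @frac_shells R d.+1 l) (1 - l).
Proof.
move=> l0 l1; rewrite /has_density.
have inv0 : (8 / s : R) @[s --> +oo] --> (0 : R).
  rewrite -[X in _ --> X](mulr0 8); apply: cvgMr.
  apply/gtr0_cvgV0; last exact: cvg_id.
  exact: nbhs_pinfty_gt.
apply: (@squeeze_cvge _ _ _ _ (fun s : R => (1 - l - 8 / s)%:E) _
  (fun s : R => (1 - l + 8 / s)%:E)).
- near=> s; have s0 : 0 < s by near: s; exact: nbhs_pinfty_gt.
  have [v -> ] := vol_shellsC_cube d l0 l1 s0.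
  rewrite ler_norml => /andP[h1 h2].
  by rewrite -EFinM !lee_fin; apply/andP; split; lra.
- apply: cvg_EFin; [exact: nearW|].
  rewrite -[X in _ --> X]subr0.
  by apply: cvgB => //; exact: cvg_cst.
- apply: cvg_EFin; [exact: nearW|].
  rewrite -[X in _ --> X]addr0.
  by apply: cvgD => //; exact: cvg_cst.
Unshelve. all: by end_near.
Qed.

(** * Isometric copies of collinear points *)

(* the name is also that of the extended distance of metric spaces *)
Local Notation edist := Defs.edist.

(** Stewart's theorem on the length of a cevian: the square distance from [z] to a
point of the line through [x] and [y] depends only on mutual distances. *)
Lemma stewart (R : realFieldType) (I : finType) (x y z : I -> R) (t : R) :
  \sum_i ((1 - t) * x i + t * y i - z i) ^+ 2 =
  (1 - t) * (\sum_i (z i - x i) ^+ 2) + t * (\sum_i (z i - y i) ^+ 2)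
    - t * (1 - t) * (\sum_i (x i - y i) ^+ 2).
Proof.
rewrite !big_distrr /= -sumrN -!big_split /=; apply: eq_bigr => i _; ring.
Qed.

Lemma edist_sqr (R : realType) (d : nat) (u v : 'rV[R]_d) :
  edist u v ^+ 2 = \sum_i (u 0 i - v 0 i) ^+ 2.
Proof. by rewrite /edist sqr_sqrtr// sumr_ge0// => i _; exact: sqr_ge0. Qed.

(** By Stewart's theorem with [t = (p - p0) / (p1 - p0)], the point
[(1 - t) f p0 + t f p1] is at distance zero from [f p].  Stewart's theorem with
[z] the origin then gives the square norm of [f p] as a polynomial in [t], whose
leading coefficient is the square distance of [f p0] and [f p1]. *)
Lemma sqnorm_collinear_copy (R : realType) (d : nat) (r : R)
    (S : pred nat) (f : nat -> 'rV[R]_d) (p0 p1 : nat) :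
  S p0 -> S p1 -> p0 != p1 ->
  (forall p q, S p -> S q -> edist (f p) (f q) = r * `|p%:R - q%:R|) ->
  exists b c : R, forall p, S p ->
    sqnorm (f p) = r ^+ 2 * p%:R ^+ 2 + b * p%:R + c.
Proof.
move=> S0 S1 p01 fd.
have d2 p q : S p -> S q ->
    \sum_i (f p 0 i - f q 0 i) ^+ 2 = r ^+ 2 * (p%:R - q%:R) ^+ 2.
  by move=> Sp Sq; rewrite -edist_sqr fd// exprMn real_normK ?num_real.
have D0 : p1%:R - p0%:R != 0 :> R by rewrite subr_eq0 eqr_nat eq_sym.
set P0 : R := p0%:R in D0 *; set P1 : R := p1%:R in D0 *.
pose n0 := sqnorm (f p0); pose n1 := sqnorm (f p1).
exists ((n1 - n0) / (P1 - P0) - r ^+ 2 * (P0 + P1)),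
  (n0 - (n1 - n0) / (P1 - P0) * P0 + r ^+ 2 * (P0 * P1)) => p Sp.
pose t := (p%:R - P0) / (P1 - P0).
have on_line i : (1 - t) * f p0 0 i + t * f p1 0 i = f p 0 i.
  have /eqP := stewart (fun i => f p0 0 i) (fun i => f p1 0 i) (fun i => f p 0 i) t.
  rewrite !d2// -/P0 -/P1.
  have -> : (1 - t) * (r ^+ 2 * (p%:R - P0) ^+ 2) + t * (r ^+ 2 * (p%:R - P1) ^+ 2)
      - t * (1 - t) * (r ^+ 2 * (P0 - P1) ^+ 2) = 0 by rewrite /t; field.
  rewrite psumr_eq0 => [/allP/(_ i (mem_index_enum i))|j _]; last exact: sqr_ge0.
  by rewrite /= sqrf_eq0 subr_eq0 => /eqP.
have := stewart (fun i => f p0 0 i) (fun i => f p1 0 i) (fun=> 0) t.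
rewrite d2// -/P0 -/P1.
under eq_bigr do rewrite on_line subr0.
under [X in (1 - t) * X]eq_bigr do rewrite sub0r sqrrN.
under [X in _ + t * X]eq_bigr do rewrite sub0r sqrrN.
rewrite -/(sqnorm (f p)) -/(sqnorm (f p0)) -/(sqnorm (f p1)) -/n0 -/n1 => ->.
by rewrite /t; field.
Qed.

Definition axis_point (R : realType) (d : nat) (p : nat) : 'rV[R]_d.+1 :=
  p%:R *: delta_mx 0 0.

Lemma edist_axis (R : realType) (d p q : nat) :
  edist (axis_point R d p) (axis_point R d q) = `|p%:R - q%:R|.
Proof.
rewrite /edist (bigD1 ord0)//= big1 => [|i i0].
  by rewrite !mxE !eqxx /= !mulr1 addr0 sqrtr_sqr.
by rewrite !mxE eqxx (negbTE i0) /= !mulr0 subrr expr0n.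
Qed.

Lemma axis_point_inj (R : realType) (d : nat) : injective (axis_point R d).
Proof.
move=> p q /rowP /(_ ord0); rewrite !mxE eqxx /= !mulr1 => /eqP.
by rewrite eqr_nat => /eqP.
Qed.

Lemma axis_in_line (R : realType) (d : nat) (A : set nat) :
  contained_in_line (axis_point R d @` A).
Proof.
exists 0, (delta_mx 0 0); split.
  apply/eqP => /rowP /(_ ord0); rewrite !mxE eqxx /= => /eqP.
  by rewrite oner_eq0.
by move=> _ [p _ <-]; exists p%:R => //=; rewrite add0r.
Qed.

Lemma card_axis (R : realType) (d : nat) (ps : seq nat) : uniq ps ->
  (axis_point R d @` [set` ps] #= `I_(size ps))%card.
Proof.
move=> ups; have -> : axis_point R d @` [set` ps] =
    (fun i => axis_point R d (nth 0%N ps i)) @` `I_(size ps).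
  apply/seteqP; split => [_ [p /= pps <-]|_ [i /= ip <-]].
    by exists (index p ps); rewrite /= ?index_mem// nth_index.
  by exists (nth 0%N ps i) => //=; exact: mem_nth.
apply: inj_card_eq => i j /set_mem/= ip /set_mem/= jp /axis_point_inj /eqP.
by rewrite nth_uniq// => /eqP.
Qed.

(** The fractional part of the square of this number is [1 / (16 K^2)^2] for all
[j]; as [p^2] is an integer, only this fractional part matters modulo one. *)
Definition dilation (R : realType) (K j : nat) : R :=
  Num.sqrt (j.+1%:R + (16 * K%:R ^+ 2) ^- 2).

Lemma dilation_sqr (R : realType) (K j : nat) :
  dilation R K j ^+ 2 = j.+1%:R + (16 * K%:R ^+ 2) ^- 2.
Proof. by rewrite sqr_sqrtr// addr_ge0// invr_ge0 exprn_even_ge0. Qed.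

Lemma dilation_gt0 (R : realType) (K j : nat) : 0 < dilation R K j.
Proof. by rewrite sqrtr_gt0 ltr_pwDl// invr_ge0 exprn_even_ge0. Qed.

Lemma dilation_cvg (R : realType) (K : nat) : dilation R K @ \oo --> +oo.
Proof.
apply/cvgryPge => A; near=> j.
apply: le_trans (ler_norm A) _; rewrite -sqrtr_sqr ler_wsqrtr//.
have : A ^+ 2 <= j%:R by near: j; exact: nbhs_infty_ger.
have : 0 <= (16 * K%:R ^+ 2) ^- 2 :> R by rewrite invr_ge0 exprn_even_ge0.
rewrite -natr1; lra.
Unshelve. all: by end_near. Qed.

(** On a copy, the square norm differs from a polynomial [quad K b c] by an
integer, and [ps] serves all these polynomials. *)
Lemma shells_hit_copies (R : realType) (d K j : nat) (l : R) (ps : seq nat) :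
  (2 <= size ps)%N -> uniq ps ->
  (forall b c : R, has (fun p => frac_lt l (quad K b c p)) ps) ->
  ~ contains_isometric_copy (dilation R K j) (axis_point R d @` [set` ps])
      (~` frac_shells l).
Proof.
move=> sz ups hit [Y [phi phiY phid] YE].
pose f p := phi (axis_point R d p).
have [||||b [c bc]] := @sqnorm_collinear_copy R _ (dilation R K j) (fun p => p \in ps) f
  (nth 0%N ps 0) (nth 0%N ps 1).
- by apply: mem_nth; apply: leq_trans sz.
- exact: mem_nth.
- by rewrite nth_uniq//; apply: leq_trans sz.
- by move=> p q pp qq; rewrite /f phid ?edist_axis//.
have /hasP[p pps] := hit b c.
have /YE : Y (f p) by case: phiY => + _ _; apply; exists p.
rewrite /frac_shells /= bc// dilation_sqr => nhit lt; apply: nhit.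
have -> : (j.+1%:R + (16 * K%:R ^+ 2) ^- 2) * p%:R ^+ 2 + b * p%:R + c =
    quad K b c p + (j.+1%:Z * p%:Z ^+ 2)%:~R.
  by rewrite /quad rmorphM rmorphXn /= -!pmulrn; ring.
by rewrite frac_ltDint.
Qed.

(** * The theorem *)

Theorem theorem1 (R : realType) :
  exists2 C : R, 0 < C &
  exists N : nat, forall d n : nat, (1 <= d)%N -> (N <= n)%N ->
  exists (E P : set 'rV[R]_d) (r : nat -> R),
    [/\ lebesgue_measurable E,
        (P #= `I_n)%card /\ contained_in_line P,
        (forall j, 0 < r j) /\ r @ \oo --> +oo,
        exists2 delta : R, has_density E delta &
          1 - C * (ln n%:R / n%:R) <= delta &
        forall j, ~ contains_isometric_copy (r j) P E].
Proof.
pose C : R := 864; have C0 : 0 < C by rewrite /C; lra.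
exists C => //; exists (Num.trunc (C ^+ 2)).+1 => -[//|d] n _ Nn.
have n_big : C <= Num.sqrt n%:R.
  rewrite -(gtr0_norm C0) -sqrtr_sqr ler_wsqrtr//.
  by apply: le_trans (ltW (truncnS_gt _)) _; rewrite ler_nat.
have [K [K3 small le_delta]] := scale_choice n_big.
have [ps [psn psU hit]] := universal_hitting R K3 small.
pose l : R := 3 / K%:R.
have K0 : 0 < K%:R :> R by rewrite ltr0n; apply: leq_trans K3.
have l0 : 0 <= l by rewrite divr_ge0// ltW.
have l1 : l <= 1 by rewrite ler_pdivrMr// mul1r (ler_nat R 3).
have n2 : (2 <= size ps)%N.
  rewrite psn -(ler_nat R); have s0 := sqrtr_ge0 (n%:R : R).
  have : Num.sqrt n%:R * Num.sqrt n%:R = n%:R :> R by rewrite -expr2 sqr_sqrtr.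
  by rewrite /C in n_big; nra.
exists (~` @frac_shells R d.+1 l), (axis_point R d @` [set` ps]), (dilation R K).
split.
- exact: shellsC_measurable.
- by split; [rewrite -psn; exact: card_axis | exact: axis_in_line].
- by split; [exact: dilation_gt0 | exact: dilation_cvg].
- by exists (1 - l); [exact: shellsC_density | rewrite lerD2l lerN2].
- by move=> j; exact: shells_hit_copies.
Qed.
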